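(* Let $R$ be a commutative ring with identity. Let $y_1, y_2, \ldots, y_n$ be a finite family of zero divisors in $R$ (repetitions allowed) satisfying $y_1 y_2 \cdots y_n = 0$. Let $N \subseteq \{1, \ldots, n\}$ be any subset such that $F_{y_i}(x)$ is defined for every $i \in N$ ($N$ need not contain every $i$ for which $F_{y_i}(x)$ is defined), and let $M = \{1, \ldots, n\} \setminus N$. Then the polynomial $$G(x) = \left(\prod_{j \in M} y_j\right)\left(\prod_{i \in N} F_{y_i}(x)\right) \in R[x]$$ is a vanishing polynomial over $R$.
   Context: For $y \in R$, let $(y) = \{qy \mid q \in R\}$ be the ideal generated by $y$. If the quotient $R/(y)$ is finite, with distinct cosets $a_1 + (y), a_2 + (y), \ldots, a_m + (y)$ (where $a_1, \ldots, a_m \in R$ is any choice of representatives, one for each coset), define $F_y(x) = (x-a_1)(x-a_2)\cdots(x-a_m) \in R[x]$. If $R/(y)$ is not finite, $F_y(x)$ is not defined. The polynomial $F_y(x)$ depends on the choice of coset representatives; the result is for any choice of representatives (chosen independently for each index $i \in N$). The element $0$ is allowed as a zero divisor. A polynomial $F(x) \in R[x]$ is a vanishing polynomial over $R$ if $F(a) = 0$ for all $a \in R$. Empty products equal $1$. *)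

(* Defs.v *)
From HB Require Import structures.
From mathcomp Require Import all_boot all_order all_algebra.
From mathcomp Require Import boolp classical_sets functions cardinality.

Set Implicit Arguments.
Unset Strict Implicit.
Unset Printing Implicit Defensive.

Import GRing.Theory.

Local Open Scope classical_set_scope.
Local Open Scope ring_scope.

Section VanishingPolynomials.
Variable R : comNzRingType.

(* 0 is a zero divisor under this definition, since 1 != 0 in R. *)
Definition zero_divisor (y : R) : Prop := exists2 z : R, z != 0 & y * z = 0.

Definition principal_ideal (y : R) : set R := [set q * y | q in [set: R]].

Definition coset (y a : R) : set R := [set a + z | z in principal_ideal y].

(* R/(y) as the set of its cosets: membership in (y) is not assumed decidable,
   so the boolean quotients of ring_quotient do not apply. *)
Definition quotient_ring (y : R) : set (set R) :=
  [set coset y a | a in [set: R]].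

Definition F_defined (y : R) : Prop := finite_set (quotient_ring y).

Definition coset_representatives (y : R) (m : nat) (a : 'I_m -> R) : Prop :=
  set_bij [set: 'I_m] (quotient_ring y) (fun k => coset y (a k)).

(* F_y(x) for the choice a of coset representatives modulo y; y itself enters
   only through the condition coset_representatives y a. *)
Definition F_poly (m : nat) (a : 'I_m -> R) : {poly R} :=
  \prod_(k < m) ('X - (a k)%:P).

Definition vanishing_poly (F : {poly R}) : Prop := forall a : R, F.[a] = 0.

End VanishingPolynomials.

(* Main.v *)
Require Import Defs.
From HB Require Import structures.
From mathcomp Require Import all_boot all_order all_algebra.
From mathcomp Require Import boolp classical_sets functions cardinality.

Set Implicit Arguments.
Unset Strict Implicit.
Unset Printing Implicit Defensive.

Import GRing.Theory.

Local Open Scope ring_scope.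

(* Every r lies in some coset a_k + (y), so the factor r - a_k of F_y(r), and
   hence F_y(r) itself, is a multiple of y; the multiples of the y_i, i in N,
   then complete the product over M to a multiple of y_1 ... y_n = 0. *)

Lemma mem_coset (R : comNzRingType) (y r : R) : coset y r r.
Proof. by exists 0; [exists 0; rewrite ?mul0r | rewrite addr0]. Qed.

Lemma F_poly_principal_ideal (R : comNzRingType) (y : R) (m : nat)
    (a : 'I_m -> R) (r : R) :
  coset_representatives y a -> principal_ideal y (F_poly a).[r].
Proof.
case=> _ _ /(_ (coset y r)) [|k _ coset_ak]; first by exists r.
have [_ [q _ <-] r_eq] : coset y (a k) r by rewrite coset_ak; apply: mem_coset.
(* Only the isolated factor [r - a k] has [r] replaced by [a k + q * y], so it collapses to [q * y];
   the other factors join [q] in the cofactor of [y]. *)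
rewrite /F_poly horner_prod (bigD1 k) //= !hornerE -[in r - _]r_eq addrAC subrr.
by rewrite add0r mulrAC; eexists.
Qed.

Theorem theorem3 (R : comNzRingType) (n : nat) (y : 'I_n -> R)
    (y_zero_divisor : forall i : 'I_n, zero_divisor (y i))
    (y_prod0 : \prod_(i < n) y i = 0)
    (N : {set 'I_n})
    (N_defined : forall i : 'I_n, i \in N -> F_defined (y i))
    (m : 'I_n -> nat) (a : forall i : 'I_n, 'I_(m i) -> R)
    (a_reps : forall i : 'I_n, i \in N ->
       coset_representatives (y i) (a i)) :
  vanishing_poly
    ((\prod_(j in ~: N) y j)%:P * \prod_(i in N) F_poly (a i)).
Proof.
move=> r; rewrite hornerM hornerC horner_prod.
(* Putting the membership in [N] under the existential makes [q] total, as [choice] requires; the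
   value 0 outside [N] is arbitrary. *)
have /choice[q F_eq] i : exists c, i \in N -> (F_poly (a i)).[r] = c * y i.
  case: (boolP (i \in N)) => [iN|_]; last by exists 0.
  by have [c _ <-] := F_poly_principal_ideal r (a_reps i iN); exists c.
(* The cofactors [q i] are pulled out in front, leaving the product of the [y j] over the complement
   of [N] times that over [N]. *)
rewrite (eq_bigr _ F_eq) big_split /= mulrCA.
rewrite (_ : _ * \prod_(i in N) y i = 0) ?mulr0 //.
rewrite -y_prod0 mulrC [RHS](bigID (mem N)) /=; congr (_ * _).
by apply: eq_bigl => i; rewrite inE.
Qed.
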